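(* Let $k\in\mathbb{N}_0$ and let $u_1<\cdots<u_k$ be positive integers. Let $\beta_1,\dots,\beta_k$ be positive real numbers satisfying $\beta_1+\cdots+\beta_k=1$. Then there are infinitely many sets $\mathcal{A}\subseteq\mathbb{N}_0$ such that for every $1\le i\le k$ $$\mathcal{S}_{u_i}^{(2)}(\mathcal{A},N)=\beta_i N+O(N^{3/4}).$$
   Context: $\mathbb{N}_0$ is the set of nonnegative integers and $\mathbb{N}$ the set of positive integers. For a nonempty set $\mathcal{A}\subseteq\mathbb{N}_0$ and an integer $n\ge 0$, $r_2(\mathcal{A},n)$ is the number of representations $n=a_1+a_2$ with $a_1\le a_2$ and $a_1,a_2\in\mathcal{A}$. For $u\in\mathbb{N}_0$ and $N\in\mathbb{N}$, $\mathcal{S}_u^{(2)}(\mathcal{A},N)=\#\{n\in\mathbb{N}: n\le N,\ r_2(\mathcal{A},n)=u\}$. The $O$-estimate is for $N\in\mathbb{N}$ with an implied constant independent of $N$ (it may depend on $k$, the $u_i$, the $\beta_i$ and $\mathcal{A}$). *)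

(* Defs.v *)
From mathcomp Require Import all_boot all_order all_algebra finmap.
From mathcomp Require Import all_classical all_reals all_analysis.

Set Implicit Arguments.
Unset Strict Implicit.
Unset Printing Implicit Defensive.

Local Open Scope classical_set_scope.

Definition reps2 (A : set nat) (n : nat) : set (nat * nat) :=
  [set a | [/\ A a.1, A a.2, (a.1 <= a.2)%N & n = (a.1 + a.2)%N]].

(* [fset_set] is only meaningful on finite sets, hence the finiteness lemmas
   accompanying [r2] and [S2]. *)
Lemma finite_reps2 (A : set nat) (n : nat) : finite_set (reps2 A n).
Proof.
apply: (@sub_finite_set _ _ (`I_n.+1 `*` `I_n.+1)).
  by move=> [a b] [_ _ _ ->]; split; rewrite /= ltnS ?leq_addr ?leq_addl.
by apply: finite_setX; exact: finite_II.
Qed.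

Definition r2 (A : set nat) (n : nat) : nat := #|` fset_set (reps2 A n)|.

Definition level2 (u : nat) (A : set nat) (N : nat) : set nat :=
  [set n | [/\ (0 < n)%N, (n <= N)%N & r2 A n = u]].

Lemma finite_level2 (u : nat) (A : set nat) (N : nat) :
  finite_set (level2 u A N).
Proof.
apply: (@sub_finite_set _ _ `I_N.+1); last exact: finite_II.
by move=> n [_ nN _].
Qed.

Definition S2 (u : nat) (A : set nat) (N : nat) : nat :=
  #|` fset_set (level2 u A N)|.

(* Main.v *)
Require Import Defs.
From mathcomp Require Import all_boot all_order all_algebra finmap.
From mathcomp Require Import all_classical all_reals all_analysis.
From mathcomp Require Import lra zify ring.

(**
  Fix a base [g] exceeding [3] and all the [u i]. Let [sigma x] be the number
  whose base-[g^2] digits are the base-[g] digits of [x]; every [n] is uniquely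
  [sigma x + g * sigma y]. Given a colouring [phi] of the naturals by indices,
  let [A] consist of all [sigma x] and all [g * sigma y + t] with
  [t < u (phi y)]. If [phi] is constant on long blocks, then a typical [n] has
  one representation for each [t < u (phi y)], [y] being the second coordinate
  of [n]: subtracting the bounded [t] from [n] rarely changes the block of [y].
  Two summands of the same kind add up to only [O(N^(3/4))] of the integers up
  to [N], because [(2 g)^2 <= g^3].

  For fixed [x] the [n = sigma x + g * sigma y] below a bound correspond to an
  initial segment of the [y], so the density of [r2 = u i] is governed by the
  discrepancy of [phi] on initial segments. A greedy colouring, with blocks of
  length about [sqrt y] near [y], has discrepancy [O(sqrt y)]; with [sqrt N]
  values of [x] and [y] up to [sqrt N] the total error is [O(N^(3/4))].
  Different bases give different sets.
*)

Set Implicit Arguments.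
Unset Strict Implicit.
Unset Printing Implicit Defensive.

Import Order.TTheory GRing.Theory Num.Theory.
Local Open Scope classical_set_scope.
Local Open Scope nat_scope.

(** * Digit interleaving *)

(* [m] is fuel. *)
Fixpoint redigit_rec (a b : nat) (F : nat -> nat) (m n : nat) : nat :=
  if m is m'.+1 then F (n %% a) + b * redigit_rec a b F m' (n %/ a) else 0.

(** Replaces each base-[a] digit [d] by [F d] and evaluates in base [b], so that one recursion
    serves both to encode and to decode. *)
Definition redigit (a b : nat) (F : nat -> nat) (n : nat) : nat :=
  redigit_rec a b F n n.

Lemma redigit_rec_fuel (a b : nat) (F : nat -> nat) (m n : nat) :
  1 < a -> F 0 = 0 -> n <= m -> redigit_rec a b F m n = redigit a b F n.
Proof.
move=> a1 F0; rewrite /redigit; elim/ltn_ind: n m => -[|n] IHn m nm.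
  by elim: m nm => //= m IHm _; rewrite mod0n F0 div0n IHm ?muln0.
case: m nm => // m nm /=; have dn : n.+1 %/ a < n.+1 by rewrite ltn_Pdiv.
by rewrite !IHn //; lia.
Qed.

Lemma redigitE (a b : nat) (F : nat -> nat) (n : nat) : 1 < a -> F 0 = 0 ->
  redigit a b F n = F (n %% a) + b * redigit a b F (n %/ a).
Proof.
move=> a1 F0; rewrite {1}/redigit; case: n => [|n] /=.
  by rewrite mod0n F0 div0n /redigit /= muln0.
by rewrite redigit_rec_fuel // -ltnS ltn_Pdiv.
Qed.

Lemma redigit_cons (a b : nat) (F : nat -> nat) (q d : nat) :
  1 < a -> F 0 = 0 -> d < a ->
  redigit a b F (q * a + d) = F d + b * redigit a b F q.
Proof.
move=> a1 F0 da; rewrite redigitE // modnMDl modn_small // divnMDl ?(ltnW a1) //.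
by rewrite divn_small // addn0.
Qed.

Notation spread a b := (redigit a b id).
Notation sqspread g := (spread g (g * g)).

Definition interleave (g x y : nat) := sqspread g x + g * sqspread g y.
(** A base-[g * g] digit [e * g + d] of [n] holds the digit [d] of [x] and the digit [e] of [y]. *)
Definition xpart (g n : nat) := redigit (g * g) g (modn^~ g) n.
Definition ypart (g n : nat) := redigit (g * g) g (divn^~ g) n.

Lemma sqspread_lt (g m x : nat) : 1 < g ->
  (sqspread g x < g ^ (2 * m)) = (x < g ^ m).
Proof.
move=> g1; have g0 : 0 < g by lia.
elim: m x => [|m IHm] x.
  rewrite muln0 !expn0 !ltnS !leqn0; elim/ltn_ind: x => x IHx.
  have [->//|x0] := eqVneq x 0; rewrite redigitE //= addn_eq0 !muln_eq0.
  rewrite (gtn_eqF g0) IHx ?ltn_Pdiv // ?lt0n //=.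
  apply/negbTE; apply: contra x0 => /andP[/eqP r0 /eqP q0].
  by rewrite (divn_eq x g) q0 r0.
rewrite redigitE //= [in RHS]expnSr -ltn_divLR // -IHm mulnS expnD expnS expn1.
have := ltn_pmod x g0; move: (x %% g) (sqspread g _) (g ^ (2 * m)) => r s c rg.
apply/idP/idP; nia.
Qed.

Lemma interleave0 (g : nat) : interleave g 0 0 = 0.
Proof. by rewrite /interleave muln0. Qed.

Lemma interleave_cons (g x y d e : nat) : 1 < g -> d < g -> e < g ->
  interleave g (x * g + d) (y * g + e) =
  interleave g x y * (g * g) + (e * g + d).
Proof. by move=> g1 dg eg; rewrite /interleave !redigit_cons //; ring. Qed.

Lemma interleave_lt (g m x y : nat) : 1 < g ->
  (interleave g x y < g ^ (2 * m)) = (x < g ^ m) && (y < g ^ m).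
Proof.
move=> g1; have g0 : 0 < g by lia.
elim: m x y => [|m IHm] x y.
  rewrite /interleave; have := sqspread_lt 0 x g1; have := sqspread_lt 0 y g1.
  by rewrite muln0 !expn0 => <- <-; apply/idP/idP; nia.
rewrite [in RHS]expnSr -!ltn_divLR // -IHm mulnS expnD expnS expn1.
rewrite {1}(divn_eq x g) {1}(divn_eq y g) interleave_cons ?ltn_pmod //.
have := ltn_pmod x g0; have := ltn_pmod y g0.
move: (interleave _ _ _) (g ^ (2 * m)) (x %% g) (y %% g) => s c r q rg qg.
apply/idP/idP; nia.
Qed.

Lemma digit_lt_sq (g d e : nat) : d < g -> e < g -> e * g + d < g * g.
Proof. nia. Qed.

Lemma xpart_interleave (g x y : nat) : 1 < g -> xpart g (interleave g x y) = x.
Proof.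
move=> g1; have g0 : 0 < g by lia.
have gg1 : 1 < g * g by nia.
elim/ltn_ind: x y => x IHx y; have [->|x0] := posnP x.
  (* For [x = 0] only [y] shrinks when a digit is removed, hence the inner induction. *)
  elim/ltn_ind: y => y IHy; have [->|y0] := posnP y.
    by rewrite interleave0.
  rewrite {1}(divn_eq y g) -[X in interleave _ X]/(0 * g + 0).
  rewrite interleave_cons ?ltn_pmod // /xpart redigit_cons ?mod0n //.
    by rewrite modnMDl mod0n -/(xpart _ _) IHy ?ltn_Pdiv // muln0.
  by rewrite digit_lt_sq ?ltn_pmod.
rewrite {1}(divn_eq y g) {1}(divn_eq x g) interleave_cons ?ltn_pmod //.
rewrite /xpart redigit_cons ?mod0n ?digit_lt_sq ?ltn_pmod //.
rewrite modnMDl modn_mod -/(xpart _ _) IHx ?ltn_Pdiv //.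
by rewrite [RHS](divn_eq x g); ring.
Qed.

Lemma ypart_interleave (g x y : nat) : 1 < g -> ypart g (interleave g x y) = y.
Proof.
move=> g1; have g0 : 0 < g by lia.
have gg1 : 1 < g * g by nia.
elim/ltn_ind: y x => y IHy x; have [->|y0] := posnP y.
  elim/ltn_ind: x => x IHx; have [->|x0] := posnP x.
    by rewrite interleave0.
  rewrite {1}(divn_eq x g) -[X in interleave _ _ X]/(0 * g + 0).
  rewrite interleave_cons ?ltn_pmod // /ypart redigit_cons ?div0n //.
    rewrite divnMDl // divn_small ?ltn_pmod //.
    by rewrite -/(ypart _ _) IHx ?ltn_Pdiv // muln0.
  by rewrite digit_lt_sq ?ltn_pmod.
rewrite {1}(divn_eq y g) {1}(divn_eq x g) interleave_cons ?ltn_pmod //.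
rewrite /ypart redigit_cons ?div0n ?digit_lt_sq ?ltn_pmod //.
rewrite divnMDl // (divn_small (ltn_pmod x g0)) addn0.
rewrite -/(ypart _ _) IHy ?ltn_Pdiv //.
by rewrite [RHS](divn_eq y g); ring.
Qed.

Lemma interleave_parts (g n : nat) : 1 < g ->
  interleave g (xpart g n) (ypart g n) = n.
Proof.
move=> g1; have g0 : 0 < g by lia.
have gg1 : 1 < g * g by nia.
elim/ltn_ind: n => n IHn; have [->|n0] := posnP n; first exact: interleave0.
rewrite /xpart /ypart [redigit _ _ _ n]redigitE ?mod0n //.
rewrite [redigit _ _ (divn^~ g) n]redigitE ?div0n //.
rewrite addnC [X in interleave _ _ X]addnC.
rewrite ![g * redigit _ _ _ _]mulnC interleave_cons ?ltn_pmod ?ltn_divLR //.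
  by rewrite -/(xpart _ _) -/(ypart _ _) IHn ?ltn_Pdiv // -divn_eq -divn_eq.
by rewrite ltn_pmod; lia.
Qed.

Lemma ypart_divn (g w n : nat) : 1 < g ->
  ypart g (n %/ g ^ (2 * w)) = ypart g n %/ g ^ w.
Proof.
move=> g1; have g0 : 0 < g by lia.
have gg1 : 1 < g * g by nia.
elim: w n => [|w IHw] n; first by rewrite muln0 !divn1.
rewrite mulnS expnD -mulnn divnMA IHw [in RHS]expnS [in RHS]divnMA; congr (_ %/ _).
rewrite [in RHS]/ypart redigitE ?div0n // addnC [g * redigit _ _ _ _]mulnC.
rewrite divnMDl //.
have r : n %% (g * g) %/ g < g by rewrite ltn_divLR // ltn_pmod; lia.
by rewrite (divn_small r) addn0.
Qed.

Lemma ypart_lt (g m n : nat) : 1 < g -> n < g ^ (2 * m) -> ypart g n < g ^ m.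
Proof.
by move=> g1; rewrite -{1}(interleave_parts n g1) interleave_lt // => /andP[].
Qed.

Lemma xpart_lt (g m n : nat) : 1 < g -> n < g ^ (2 * m) -> xpart g n < g ^ m.
Proof.
by move=> g1; rewrite -{1}(interleave_parts n g1) interleave_lt // => /andP[].
Qed.

Lemma ltn_sqspread (g : nat) : 1 < g -> {homo sqspread g : x y / x < y}.
Proof.
move=> g1; have g0 : 0 < g by lia.
move=> x y; elim/ltn_ind: y x => y IHy x xy; have y0 : 0 < y by lia.
rewrite [sqspread g x]redigitE // [sqspread g y]redigitE //=.
have xg := ltn_pmod x g0; have yg := ltn_pmod y g0.
have := leq_div2r g (ltnW xy); rewrite leq_eqVlt => /predU1P[qE|qlt].
  rewrite qE ltn_add2r; have := divn_eq x g; have := divn_eq y g; nia.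
have := IHy _ (ltn_Pdiv g1 y0) _ qlt; nia.
Qed.

(** Digitwise sums are at most [2 * g - 2], so they form a base-[2 * g] numeral [z]. This makes the
    sums of two spread numbers sparse. *)
Lemma sqspread_add (g m x y : nat) : 1 < g -> x < g ^ m -> y < g ^ m ->
  exists2 z, z < (2 * g) ^ m &
    sqspread g x + sqspread g y = spread (2 * g) (g * g) z.
Proof.
move=> g1; have g0 : 0 < g by lia.
have gg1 : 1 < 2 * g by lia.
elim: m x y => [|m IHm] x y.
  by rewrite !expn0 !ltnS !leqn0 => /eqP -> /eqP ->; exists 0.
rewrite expnSr -!ltn_divLR // => xm ym; have [z zm zE] := IHm _ _ xm ym.
have xg := ltn_pmod x g0; have yg := ltn_pmod y g0.
exists (z * (2 * g) + (x %% g + y %% g)); first by rewrite expnSr; nia.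
rewrite redigit_cons //; last lia.
by rewrite redigitE // [in X in _ + X]redigitE //= -zE; ring.
Qed.

(** * Representation counts *)

Definition interleaved_set (g : nat) (v : nat -> nat) : set nat :=
  [set a | (exists x, a = sqspread g x) \/
           (exists y t, t < v y /\ a = g * sqspread g y + t)].

(** The last two fields serve the colouring: [y] is large enough for its block of length [g ^ w] to
    be monochromatic, and subtracting [t < U] from [n] leaves that block unchanged. *)
Record generic (g w U n : nat) : Prop := Generic {
  generic_low : forall x x', n <> sqspread g x + sqspread g x';
  generic_high : forall y y' t t', t < U -> t' < U ->
    n <> (g * sqspread g y + t) + (g * sqspread g y' + t');
  generic_ypart : g ^ w <= ypart g n %/ g ^ w;
  generic_mod : U <= n %% g ^ (2 * w) }.

(** The exponent [6 * w] is three quarters of [8 * w]: the exceptions below [g ^ (8 * w)] obey the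
    final error bound. *)
Lemma generic_outside_seq (g w U : nat) : 3 < g -> U < g ->
  exists2 L : seq nat, size L <= 4 * g * g ^ (6 * w) &
    forall n, n < g ^ (8 * w) -> n \notin L -> generic g w U n.
Proof.
move=> g3 Ug; have g1 : 1 < g by lia.
have g0 : 0 < g by lia.
have gw e : 0 < g ^ e by rewrite expn_gt0 g0.
have cw : (2 * g) ^ (4 * w) <= g ^ (6 * w).
  have [-> ->] : 4 * w = 2 * (2 * w) /\ 6 * w = 3 * (2 * w) by lia.
  rewrite [(2 * g) ^ _]expnM [g ^ _]expnM.
  have [->//|w0] := posnP (2 * w); rewrite leq_exp2r //.
  by rewrite expnMn (expnS g 2) leq_mul2r orbC g3.
have size_le c X : c <= X ->
    c + (c * (2 * g) + (X + X * U)) <= 4 * g * X.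
  move=> cX; have : c * (2 * g) <= X * (2 * g) by rewrite leq_mul2r cX orbT.
  have : X * U <= X * (g - 1) by rewrite leq_mul2l; apply/orP; right; lia.
  have : X * 3 <= X * g by rewrite leq_mul2l ltnW ?orbT.
  nia.
set c := (2 * g) ^ (4 * w) in cw *.
(* One list per field of [generic], in the same order, containing the numbers that violate it. *)
pose L1 := map (spread (2 * g) (g * g)) (iota 0 c).
pose L2 := allpairs (fun z e => g * spread (2 * g) (g * g) z + e)
  (iota 0 c) (iota 0 (2 * g)).
pose L3 := allpairs (interleave g) (iota 0 (g ^ (4 * w))) (iota 0 (g ^ (2 * w))).
pose L4 := allpairs (fun q r => q * g ^ (2 * w) + r)
  (iota 0 (g ^ (6 * w))) (iota 0 U).
have square_lt x n : sqspread g x <= n -> n < g ^ (8 * w) -> x < g ^ (4 * w).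
  move=> xn nw; rewrite -sqspread_lt // (leq_ltn_trans xn) //.
  by rewrite mulnA.
exists (L1 ++ L2 ++ L3 ++ L4).
  rewrite !size_cat size_map !size_allpairs !size_iota -expnD.
  have -> : 4 * w + 2 * w = 6 * w by lia.
  exact: size_le.
move=> n nw; rewrite !mem_cat !negb_or => /and4P[n1 n2 n3 n4]; split.
- move=> x x' nE; have [||z zc zE] := @sqspread_add g (4 * w) x x' g1.
  + by apply: square_lt nw; rewrite nE leq_addr.
  + by apply: square_lt nw; rewrite nE leq_addl.
  by case/mapP: n1; exists z; rewrite ?mem_iota // nE.
- move=> y y' t t' tU tU' nE; have [||z zc zE] := @sqspread_add g (4 * w) y y' g1.
  + apply: square_lt nw; rewrite nE (leq_trans (leq_pmull _ g0)) //.
    by rewrite -!addnA leq_addr.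
  + apply: square_lt nw; rewrite nE (leq_trans (leq_pmull _ g0)) //.
    by rewrite addnCA leq_addr.
  case/allpairsP: n2; exists (z, t + t'); rewrite !mem_iota /=; split=> //.
    by lia.
  by rewrite nE -zE; ring.
- rewrite leq_divRL // -expnD addnn -mul2n leqNgt; apply/negP => yw.
  case/allpairsP: n3; exists (xpart g n, ypart g n).
  rewrite !mem_iota interleave_parts //= yw; split=> //.
  by apply: xpart_lt => //; rewrite mulnA.
- rewrite leqNgt; apply/negP => rU; case/allpairsP: n4.
  exists (n %/ g ^ (2 * w), n %% g ^ (2 * w)); rewrite !mem_iota /= rU -divn_eq.
  split=> //; rewrite ltn_divLR // -expnD.
  by rewrite (_ : 6 * w + 2 * w = 8 * w) //; lia.
Qed.

(** A representation must pair a [sqspread g x] with a [g * sqspread g y + t]; then [x] and [y] are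
    the parts of [n - t], so [t] alone determines it. *)
Lemma r2_interleaved_set (g w U n : nat) (v : nat -> nat) :
  1 < g -> U < g -> (forall y, v y <= U) ->
  (forall y z, y %/ g ^ w = z %/ g ^ w -> g ^ w <= y %/ g ^ w -> v y = v z) ->
  generic g w U n -> r2 (interleaved_set g v) n = v (ypart g n).
Proof.
move=> g1 Ug vU v_run [n_low n_high yw nU].
have g0 : 0 < g by lia.
(* Since [U <= n %% g ^ (2 * w)], subtracting [t] borrows nothing from the digits that determine the
   block of [y]. *)
have v_shift t : t < U -> v (ypart g (n - t)) = v (ypart g n).
  move=> tU; apply/esym/v_run => //; rewrite -!ypart_divn //; congr ypart.
  rewrite {2}(divn_eq n (g ^ (2 * w))) -addnBA; last lia.
  rewrite divnMDl ?expn_gt0 ?g0 // [X in _ + X]divn_small ?addn0 //.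
  by rewrite (leq_ltn_trans (leq_subr _ _)) // ltn_pmod // expn_gt0 g0.
pose a t := sqspread g (xpart g (n - t)).
pose b t := g * sqspread g (ypart g (n - t)) + t.
have abE t : t < U -> a t + b t = n.
  move=> tU; rewrite /a /b addnA -/(interleave _ _ _) interleave_parts //.
  by rewrite subnK //; have := leq_mod n (g ^ (2 * w)); lia.
have b_inj : {in `I_(v (ypart g n)) &, injective b}.
  move=> s t /set_mem /= sv /set_mem /= tv; rewrite /b.
  have vUn := vU (ypart g n); move=> /(congr1 (modn^~ g)).
  by rewrite ![g * redigit _ _ _ _]mulnC !modnMDl !modn_small //; lia.
pose f t := (minn (a t) (b t), maxn (a t) (b t)).
rewrite /r2; apply: card_fset_set.
have -> : reps2 (interleaved_set g v) n = f @` `I_(v (ypart g n)).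
  apply/seteqP; split=> [[p q] [/= Ap Aq pq nE]|_ [t /= tv <-]].
    have pqP s y t : n = sqspread g s + (g * sqspread g y + t) -> t < v y ->
        [/\ t < v (ypart g n), a t = sqspread g s & b t = g * sqspread g y + t].
      move=> nE' tv; have ntE : n - t = interleave g s y.
        by rewrite nE' addnA addnK.
      have yE : ypart g (n - t) = y by rewrite ntE ypart_interleave.
      rewrite /a /b yE ntE xpart_interleave // -(v_shift t) ?yE //.
      exact: leq_trans tv (vU y).
    case: Ap Aq => [[x pE]|[y [t [tv pE]]]] [[x' qE]|[y' [t' [tv' qE]]]].
    + by case: (n_low x x'); rewrite nE pE qE.
    + have [|tn aE bE] := pqP x y' t' _ tv'; first by rewrite nE pE qE.
      exists t' => //; rewrite /f aE bE -pE -qE.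
      by rewrite (minn_idPl pq) (maxn_idPr pq).
    + have [|tn aE bE] := pqP x' y t _ tv; first by rewrite nE pE qE addnC.
      exists t => //; rewrite /f aE bE -pE -qE.
      by rewrite (minn_idPr pq) (maxn_idPl pq).
    + case: (n_high y y' t t'); last by rewrite nE pE qE.
        exact: leq_trans tv (vU y).
      exact: leq_trans tv' (vU y').
  have tU := leq_trans tv (vU _).
  have Aa : interleaved_set g v (a t) by left; exists (xpart g (n - t)).
  have Ab : interleaved_set g v (b t).
    by right; exists (ypart g (n - t)), t; rewrite v_shift.
  split=> /=; last by rewrite addn_min_max abE.
  - by case: leqP.
  - by case: leqP.
  - by rewrite geq_min !leq_max !leqnn.
apply: inj_card_eq => s t sv tv fE; have := set_mem sv; have := set_mem tv.
rewrite /= => tv' sv'; have sU := leq_trans sv' (vU _).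
have tU := leq_trans tv' (vU _).
(* Equal sorted pairs either have [b s = b t] or are swapped; a swap would give [n = b s + b t],
   against [generic_high]. *)
have minmax p q p' q' : minn p q = minn p' q' -> maxn p q = maxn p' q' ->
    q = q' \/ p' = q by lia.
have [bst|ast] : b s = b t \/ a t = b s.
  by case: fE => /minmax e /e.
  exact: b_inj.
by case: (n_high (ypart g (n - s)) (ypart g (n - t)) s t sU tU);
  rewrite -[RHS]/(b s + b t) -ast abE.
Qed.

Lemma S2E (u : nat) (A : set nat) (N : nat) :
  S2 u A N = \sum_(0 <= n < N.+1) ((0 < n) && (r2 A n == u)).
Proof.
pose s := [seq n <- index_iota 0 N.+1 | (0 < n) && (r2 A n == u)].
have -> : S2 u A N = size s.
  rewrite /S2 (_ : level2 u A N = [set` [fset n in s]%fset]).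
    by rewrite set_fsetK card_fseq undup_id // filter_uniq ?iota_uniq.
  apply/seteqP; split=> n; rewrite /= inE mem_filter mem_index_iota ltnS.
    by case=> -> -> /eqP ->.
  by move=> /andP[/andP[n0 /eqP nu] nN]; split.
by rewrite size_filter -sum1_count big_mkcond.
Qed.

Local Open Scope classical_set_scope.
Local Open Scope ring_scope.

(** * Colourings of small discrepancy *)

(* The state is the vector of deficits [beta i * y - #{z < y | phi z = i}]
   together with the current colour, which may change only at points of [p].
   The deficits sum to zero, so a nonnegative one always exists. *)
Fixpoint greedy (R : realFieldType) (k : nat) (beta : 'I_k -> R) (p : pred nat)
    (i0 : 'I_k) (y : nat) : ('I_k -> R) * 'I_k :=
  if y is z.+1 then
    let: (e, c) := greedy beta p i0 z in
    let e' := fun i => e i + beta i - (c == i)%:R in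
    (e', if p z.+1 then odflt c [pick i | 0 <= e' i] else c)
  else (fun=> 0, i0).

(** A colour is chosen with nonnegative deficit and kept for at most [L] steps until the next
    choice, losing at most 1 per step; so no deficit falls below [-L]. The zero sum turns this into
    an upper bound. *)
Lemma balanced_coloring (R : realFieldType) (k : nat) (beta : 'I_k -> R)
    (p : pred nat) :
  (forall i, 0 <= beta i) -> \sum_i beta i = 1 ->
  exists phi : nat -> 'I_k,
    (forall y, ~~ p y.+1 -> phi y.+1 = phi y) /\
    forall L Y : nat,
      (forall b, (b < Y)%N -> exists2 a, p a & (a <= b < a + L)%N) ->
      forall i,
        `|\sum_(0 <= y < Y) ((phi y == i)%:R - beta i)| <= k%:R * L%:R.
Proof.
move=> beta0 beta1.
have [i0 _] : exists i0 : 'I_k, true.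
  case: k beta beta0 beta1 => [|k] beta _ beta1; last by exists ord0.
  by move: beta1; rewrite big_ord0 => /esym/eqP; rewrite oner_eq0.
pose e y := (greedy beta p i0 y).1; pose phi y := (greedy beta p i0 y).2.
have eS y i : e y.+1 i = e y i + beta i - (phi y == i)%:R.
  by rewrite /e /phi /=; case: greedy.
have phiS y : phi y.+1 =
    if p y.+1 then odflt (phi y) [pick i | 0 <= e y.+1 i] else phi y.
  rewrite /e /phi /=; case: greedy => f c /=; case: ifP => // _.
have e_sum y : \sum_i e y i = 0.
  elim: y => [|y IHy]; first by rewrite big1.
  under eq_bigr do rewrite eS.
  rewrite big_split sumrN big_split /= IHy beta1 (bigD1 (phi y)) //= eqxx.
  rewrite big1 => [|i /negPf]; last by rewrite eq_sym => ->.
  by rewrite addr0 add0r subrr.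
have e_nneg y : exists i, 0 <= e y i.
  apply/existsP; rewrite -[X in is_true X]negbK negb_exists; apply/negP.
  move=> /forallP eN; have := e_sum y; apply/eqP; rewrite lt_eqF //.
  rewrite (bigD1 i0) //= ltr_wnDr //; last by rewrite ltNge eN.
  by apply: sumr_le0 => i _; rewrite ltW // ltNge eN.
have eE y i : e y i = - \sum_(0 <= z < y) ((phi z == i)%:R - beta i).
  elim: y => [|y IHy]; first by rewrite big_geq // oppr0.
  by rewrite big_nat_recr //= eS IHy; ring.
(* [y0] is the last point of choice up to [y], or 0 if there was none. *)
have e_cur y : exists y0, [/\ (y0 <= y)%N, forall z, (y0 < z <= y)%N -> ~~ p z
    & - (y - y0)%:R <= e y (phi y)].
  elim: y => [|y [y0 [y0y Np ey]]].
    by exists 0%N; split => // [z|]; [lia|rewrite oppr0].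
  case py: (p y.+1).
    exists y.+1; split=> // [z|]; first lia.
    (* The default of [odflt] is never reached, by [e_nneg]. *)
    rewrite subnn oppr0 phiS py; case: pickP => //= Nex.
    by have [i] := e_nneg y.+1; rewrite Nex.
  exists y0; split=> [|z|]; first lia.
    have [-> _|zy] := eqVneq z y.+1; first by rewrite py.
    by move=> zy'; apply: Np; lia.
  rewrite phiS py eS eqxx subSn // -natr1; have := beta0 (phi y).
  by rewrite mulr1n; lra.
have e_lb L Y : (forall b, (b < Y)%N -> exists2 a, p a & (a <= b < a + L)%N) ->
    forall i, - L%:R <= e Y i.
  elim: Y => [_ i|Y IHY gap i].
    by rewrite eE big_geq // oppr0 oppr_le0.
  have {}IHY := IHY (fun b bY => gap b (ltnW bY)) i.
  rewrite eS; have [<-|_] := eqVneq (phi Y) i; last first.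
    have := beta0 i; rewrite /=; lra.
  have [y0 [y0Y Np eY]] := e_cur Y.
  have [a pa aY] := gap Y (ltnSn _).
  have ay0 : (a <= y0)%N.
    by rewrite leqNgt; apply/negP => y0a; have := Np a; rewrite pa; lia.
  have : (Y - y0).+1%:R <= L%:R :> R by rewrite ler_nat; lia.
  rewrite -natr1; have := beta0 (phi Y); rewrite /=; lra.
exists phi; split=> [y /negPf py|L Y gap i]; first by rewrite phiS py.
rewrite -normrN -eE ler_norml; apply/andP; split.
  apply: le_trans (e_lb _ _ gap i); rewrite lerN2 ler_peMl ?ler0n //.
  by rewrite ler1n (leq_ltn_trans _ (ltn_ord i0)).
have -> : e Y i = - \sum_(j | j != i) e Y j.
  by have := e_sum Y; rewrite (bigD1 i) //= => /eqP; rewrite addr_eq0 => /eqP.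
rewrite -sumrN (@le_trans _ _ (\sum_(j | j != i) L%:R)) //.
  by apply: ler_sum => j _; rewrite lerNl; exact: e_lb.
rewrite sumr_const -[leLHS]mulr_natl ler_wpM2r ?ler0n // ler_nat.
by rewrite -[leqRHS]card_ord max_card.
Qed.

(** [interleave g] maps the square of side [g ^ m] bijectively onto the numbers below
    [g ^ (2 * m)]. *)
Lemma sum_interleave (V : nmodType) (g m : nat) (F : nat -> V) : (1 < g)%N ->
  \sum_(0 <= n < g ^ (2 * m)) F n =
  \sum_(0 <= x < g ^ m) \sum_(0 <= y < g ^ m) F (interleave g x y).
Proof.
move=> g1; rewrite !big_mkord; under [RHS]eq_bigr do rewrite big_mkord.
rewrite pair_bigA /=.
pose h (n : 'I_(g ^ (2 * m))) : 'I_(g ^ m) * 'I_(g ^ m) :=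
  (Ordinal (xpart_lt g1 (ltn_ord n)), Ordinal (ypart_lt g1 (ltn_ord n))).
rewrite (reindex h) /=.
  by apply: eq_bigr => n _; rewrite interleave_parts.
have hP (c : 'I_(g ^ m) * 'I_(g ^ m)) : (interleave g c.1 c.2 < g ^ (2 * m))%N.
  by rewrite interleave_lt // !ltn_ord.
exists (fun c => Ordinal (hP c)) => [n _|[x y] _].
  by apply: val_inj; rewrite /= interleave_parts.
congr pair; apply: val_inj; rewrite /=.
  by rewrite xpart_interleave.
by rewrite ypart_interleave.
Qed.

Lemma initial_segmentP (q : pred nat) (H : nat) :
  (forall y z, (y <= z)%N -> q z -> q y) ->
  exists2 Y, (Y <= H)%N & forall y, (y < H)%N -> q y = (y < Y)%N.
Proof.
move=> q_down; elim: H => [|H [Y YH qY]]; first by exists 0%N.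
have [YltH|HY] := ltnP Y H.
  exists Y => [|y]; first exact: ltnW.
  rewrite ltnS leq_eqVlt => /predU1P[->|/qY//].
  rewrite ltnNge (ltnW YltH) /=; apply/negP => /(q_down _ _ (ltnW YltH)).
  by rewrite qY // ltnn.
exists (H + q H)%N => [|y]; first by case: (q H); lia.
rewrite ltnS leq_eqVlt => /predU1P[->|yH]; first by case: (q H); lia.
by rewrite qY //; case: (q H); lia.
Qed.

(* For fixed [x], monotonicity of [interleave g x] makes the condition
   [interleave g x y < M] cut out an initial segment of the [y]. *)
Lemma ypart_discrepancy (R : realFieldType) (g m M : nat) (c : nat -> R) (D : R) :
  (1 < g)%N -> (M <= g ^ (2 * m))%N ->
  (forall Y, (Y <= g ^ m)%N -> `|\sum_(0 <= y < Y) c y| <= D) ->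
  `|\sum_(0 <= n < M) c (ypart g n)| <= (g ^ m)%:R * D.
Proof.
(* The range is widened to a full square, with [n < M] kept as a condition. *)
move=> g1 Mm cD; rewrite (big_nat_widen _ _ _ _ _ Mm) big_mkcond sum_interleave //.
apply: le_trans (ler_norm_sum _ _ _) _.
rewrite mulr_natl -[X in _ *+ X]subn0 -sumr_const_nat.
apply: ler_sum => x _; rewrite -big_mkcond /=.
have [y z|Y YH qY] := @initial_segmentP (fun y => interleave g x y < M)%N (g ^ m).
  rewrite leq_eqVlt => /predU1P[-> //|yz]; apply: leq_ltn_trans.
  by rewrite leq_add2l leq_mul2l ltnW ?orbT // ltn_sqspread.
rewrite big_nat_cond.
rewrite (eq_bigl (fun y => (0 <= y < g ^ m)%N && (y < Y)%N)); last first.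
  move=> y /=; case yH: (y < g ^ m)%N; rewrite ?andbF //=; exact: qY.
rewrite -big_nat_cond -(big_nat_widen _ _ _ xpredT) //.
under eq_bigr do rewrite ypart_interleave //.
exact: cD.
Qed.

Lemma multiscale_coloring (R : realFieldType) (k g : nat) (beta : 'I_k -> R) :
  (1 < g)%N -> (forall i, 0 <= beta i) -> \sum_i beta i = 1 ->
  exists phi : nat -> 'I_k,
    (forall w y z, (y %/ g ^ w = z %/ g ^ w)%N -> (g ^ w <= y %/ g ^ w)%N ->
      phi y = phi z) /\
    forall w Y i, (Y <= g ^ (2 * w))%N ->
      `|\sum_(0 <= y < Y) ((phi y == i)%:R - beta i)| <= k%:R * (g ^ w)%:R.
Proof.
move=> g1 beta0 beta1; have g0 : (0 < g)%N by lia.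
have gg1 : (1 < g * g)%N by nia.
(* For [g ^ (2 * s) <= z < g ^ (2 * s + 2)], changes are allowed exactly at multiples of [g ^ s],
   which is of order [sqrt z]. *)
pose p z := (g ^ trunc_log (g * g) z %| z)%N.
have [phi [phi_run phi_disc]] := balanced_coloring p beta0 beta1.
exists phi; split.
  move=> w y z yz wy.
  suff run q r : (g ^ w <= q)%N -> (r < g ^ w)%N ->
      phi (q * g ^ w + r)%N = phi (q * g ^ w)%N.
    have runE x : (g ^ w <= x %/ g ^ w)%N -> phi x = phi (x %/ g ^ w * g ^ w)%N.
      by move=> xw; rewrite {1}(divn_eq x (g ^ w)) run // ltn_pmod // expn_gt0 g0.
    by rewrite runE // yz -runE // -yz.
  move=> wq; elim: r => [|r IHr] rw; first by rewrite addn0.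
  rewrite addnS phi_run ?IHr 1?ltnW //.
  (* From [g ^ (2 * w)] on, points of [p] are multiples of [g ^ w], and none lies strictly inside a
     block. *)
  apply/negP => /(dvdn_trans _) pz.
  have /pz : (g ^ w %| g ^ trunc_log (g * g) (q * g ^ w + r).+1)%N.
    rewrite dvdn_exp2l // trunc_log_max // mulnn -expnM mulnC expnM.
    by rewrite -mulnn; nia.
  rewrite -addnS dvdn_addr ?dvdn_mull // => /(dvdn_leq (ltn0Sn _)); lia.
move=> w Y i Yw; apply: phi_disc => b bY.
have [->|b0] := posnP b.
  by exists 0%N; [exact: dvdn0|rewrite add0n expn_gt0 g0].
set s := trunc_log (g * g) b.
have /andP[sb bs] : (g ^ s * g ^ s <= b < g ^ s.+1 * g ^ s.+1)%N.
  by rewrite -!expnMn; exact: trunc_log_bounds.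
have gs0 : (0 < g ^ s)%N by rewrite expn_gt0 g0.
(* Rounding [b] down to a multiple of [g ^ s] does not go below [g ^ s * g ^ s], so the scale [s] is
   kept and the result lies in [p]. *)
have sq : (g ^ s <= b %/ g ^ s)%N by rewrite leq_divRL.
have ab : (b %/ g ^ s * g ^ s <= b)%N by exact: leq_trunc_div.
have as_ : trunc_log (g * g) (b %/ g ^ s * g ^ s) = s.
  apply: trunc_log_eq => //; rewrite !expnMn (leq_ltn_trans ab bs) andbT.
  by rewrite leq_mul2r sq orbT.
exists (b %/ g ^ s * g ^ s)%N; first by rewrite /p as_ dvdn_mull.
rewrite ab /=; have sw : (s <= w)%N.
  rewrite leqNgt; apply/negP => ws.
  have : (b < g ^ s * g ^ s)%N; last by lia.
  apply: leq_trans bY _; apply: leq_trans Yw _.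
  by rewrite -expnD leq_exp2l //; lia.
have := ltn_pmod b gs0; have := divn_eq b (g ^ s).
have : (g ^ s <= g ^ w)%N by rewrite leq_exp2l.
lia.
Qed.

(** * Counting levels *)

Lemma sqspread_digit (g x : nat) : (x < g)%N -> sqspread g x = x.
Proof.
move=> xg; have [->//|x0] := posnP x.
have g1 : (1 < g)%N by lia.
rewrite -[in LHS](add0n x) -(mul0n g) redigit_cons //.
by rewrite [redigit _ _ _ 0]/= muln0 addn0.
Qed.

(** The number [2 * g - 1] separates the sets. It is a single digit in base [h]; in base [g] it has
    residue [g - 1], too large for an offset [t < v y < g], and it is no value of [sqspread g]. *)
Lemma interleaved_set_neq (g h : nat) (v w : nat -> nat) : (1 < g)%N ->
  (forall y, v y < g)%N -> (2 * g <= h)%N ->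
  interleaved_set g v <> interleaved_set h w.
Proof.
move=> g1 vg gh /(congr1 (fun A : set nat => A (2 * g).-1)) AE.
have : interleaved_set h w (2 * g).-1.
  by left; exists (2 * g).-1; rewrite sqspread_digit //; lia.
rewrite -AE => -[[x xE]|[y [t [tv tE]]]].
  have xg : (x < g)%N.
    by have := sqspread_lt 1 x g1; rewrite expn1 => <-; rewrite -xE; nia.
  by move: xE; rewrite sqspread_digit //; lia.
have := vg y => vyg.
have := congr1 (modn^~ g) tE.
rewrite [(g * _)%N]mulnC modnMDl (_ : (2 * g).-1 = 1 * g + (g - 1))%N; last lia.
by rewrite modnMDl !modn_small; lia.
Qed.

Lemma sum_mem_le_size (L : seq nat) (M : nat) :
  (\sum_(0 <= n < M) (n \in L) <= size L)%N.
Proof.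
rewrite -big_mkcond sum1_count -size_filter uniq_leq_size ?filter_uniq ?iota_uniq //.
by move=> n; rewrite mem_filter => /andP[].
Qed.

(** The three terms of the constant bound the exceptional [n], the discrepancy of the colouring, and
    the extra index 0 in sums of [N.+1] terms. *)
Lemma S2_interleaved_set (R : realType) (k g U : nat) (u : 'I_k -> nat)
    (beta : 'I_k -> R) (phi : nat -> 'I_k) (w N : nat) (i : 'I_k) :
  (3 < g)%N -> (U < g)%N -> (forall j, u j <= U)%N -> injective u ->
  (forall w y z, (y %/ g ^ w = z %/ g ^ w)%N -> (g ^ w <= y %/ g ^ w)%N ->
    phi y = phi z) ->
  (forall w Y i, (Y <= g ^ (2 * w))%N ->
    `|\sum_(0 <= y < Y) ((phi y == i)%:R - beta i)| <= k%:R * (g ^ w)%:R) ->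
  (N < g ^ (8 * w))%N ->
  `|(S2 (u i) (interleaved_set g (u \o phi)) N)%:R - beta i * N%:R| <=
    ((4 * g)%:R + k%:R + `|beta i|) * (g ^ (6 * w))%:R.
Proof.
move=> g3 Ug uU u_inj phi_run phi_disc Nw; have g1 : (1 < g)%N by lia.
have [L Lw L_generic] := generic_outside_seq w g3 Ug.
set A := interleaved_set _ _.
pose hit n : R := ((0 < n)%N && (r2 A n == u i))%:R.
pose aim n : R := (phi (ypart g n) == i)%:R.
have -> : (S2 (u i) A N)%:R - beta i * N%:R =
    \sum_(0 <= n < N.+1) (hit n - aim n) +
    \sum_(0 <= n < N.+1) (aim n - beta i) + beta i.
  rewrite S2E natr_sum !sumrB sumr_const_nat subn0 mulrSr -[beta i *+ N]mulr_natr.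
  by rewrite /hit; ring.
rewrite 2!mulrDl; apply: le_trans (ler_normD _ _) (lerD _ _); last first.
  by rewrite ler_peMr // ler1n expn_gt0 (ltnW g1).
apply: le_trans (ler_normD _ _) (lerD _ _).
  apply: le_trans (ler_norm_sum _ _ _) _.
  apply: (@le_trans _ _ (\sum_(0 <= n < N.+1) (n \in L)%:R)); last first.
    rewrite -natr_sum -natrM ler_nat.
    exact: leq_trans (sum_mem_le_size _ _) Lw.
  rewrite !big_nat; apply: ler_sum => n /andP[_ nN].
  case nL: (n \in L).
    by rewrite /hit /aim; case: (_ && _); case: (_ == _);
      rewrite ?subrr ?subr0 ?sub0r ?normrN ?normr0 ?normr1.
  have n_generic := L_generic n (leq_trans nN Nw) (negbT nL).
  (* 0 is not generic, being [sqspread g 0 + sqspread g 0]. *)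
  have n0 : (0 < n)%N.
    case: n {nN nL} n_generic => // -[/(_ 0%N 0%N) + _ _ _].
    by rewrite sqspread_digit ?(ltnW g1).
  have r2E : r2 A n = u (phi (ypart g n)).
    apply: (r2_interleaved_set g1 Ug _ _ n_generic) => [y|y z yz yw].
      exact: uU.
    by rewrite /= (phi_run w y z).
  by rewrite /hit /aim n0 r2E (inj_eq u_inj) subrr normr0.
(* There are [g ^ (4 * w)] values of [x], each with discrepancy at most [k * g ^ (2 * w)]. *)
have -> : k%:R * (g ^ (6 * w))%:R =
    (g ^ (4 * w))%:R * (k%:R * (g ^ (2 * w))%:R) :> R.
  by rewrite (_ : 6 * w = 4 * w + 2 * w)%N ?expnD ?natrM; [ring|lia].
apply: (ypart_discrepancy (c := fun y => (phi y == i)%:R - beta i)) => //.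
  by rewrite mulnA.
by move=> Y YH; apply: phi_disc; rewrite mulnA.
Qed.

Lemma natr_powR34 (R : realType) (g v N : nat) : (g ^ (8 * v) <= N)%N ->
  (g ^ (6 * v))%:R <= N%:R `^ (3 / 4) :> R.
Proof.
move=> gN; pose x : R := (g ^ (2 * v))%:R.
have -> : (g ^ (6 * v))%:R = (x ^+ 4) `^ (3 / 4).
  rewrite -powR_mulrn ?ler0n // -powRrM (_ : 4%:R * _ = 3%:R); last by field.
  rewrite powR_mulrn ?ler0n // -natrX -expnM; congr (g ^ _)%:R; lia.
rewrite -natrX -expnM; apply: ge0_ler_powR; rewrite ?nnegrE ?ler0n //.
rewrite ler_nat (leq_trans _ gN) // (_ : 2 * v * 4 = 8 * v)%N //; lia.
Qed.

Theorem corollary1p2 (R : realType) (k : nat) (u : 'I_k -> nat)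
    (beta : 'I_k -> R)
    (u_gt0 : forall i : 'I_k, (0 < u i)%N)
    (u_incr : forall i j : 'I_k, (i < j)%N -> (u i < u j)%N)
    (beta_gt0 : forall i : 'I_k, 0 < beta i)
    (beta_sum : \sum_(i < k) beta i = 1) :
  infinite_set [set A : set nat | A !=set0 /\
    forall i : 'I_k, exists C : R, forall N : nat, (0 < N)%N ->
      `|(S2 (u i) A N)%:R - beta i * N%:R| <= C * N%:R `^ (3 / 4)].
Proof.
set good := [set A | _].
have u_inj : injective u.
  move=> i j uij; apply/val_inj.
  by case: (ltngtP i j) => // /u_incr; rewrite uij ltnn.
pose U := (\max_i u i)%N.
have uU j : (u j <= U)%N by exact: leq_bigmax.
(* The factor [4 + U] makes the base exceed 3 and [U]; the powers of 2 give [2 * g i <= g j] for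
   [i < j], as needed to separate the sets. *)
pose g j := ((4 + U) * 2 ^ j)%N.
have gU j : (4 + U <= g j)%N by rewrite leq_pmulr // expn_gt0.
have g3 j : (3 < g j)%N by have := gU j; lia.
have Ug j : (U < g j)%N by have := gU j; lia.
have g1 j : (1 < g j)%N by have := gU j; lia.
have beta_ge0 i := ltW (beta_gt0 i).
have /choice[phi phiP] j := multiscale_coloring (g1 j) beta_ge0 beta_sum.
pose f j := interleaved_set (g j) (u \o phi j).
have f_good j : good (f j).
  split; first by exists 0%N; left; exists 0%N.
  have [phi_run phi_disc] := phiP j.
  (* [N] lies between consecutive powers of [g j ^ 8]; the factor [g j ^ 6] pays for passing from
     the upper power to the lower. *)
  move=> i; exists (((4 * g j)%:R + k%:R + `|beta i|) * (g j ^ 6)%:R) => N N0.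
  have g8 : (1 < g j ^ 8)%N by rewrite -(exp1n 8) ltn_exp2r.
  pose v := trunc_log (g j ^ 8) N.
  have Nv : (N < g j ^ (8 * v.+1))%N by rewrite expnM trunc_log_ltn.
  have := S2_interleaved_set i (g3 j) (Ug j) uU u_inj phi_run phi_disc Nv.
  move=> /le_trans; apply.
  rewrite mulnS expnD (natrM _ (_ ^ 6)) mulrA.
  rewrite ler_wpM2l ?mulr_ge0 ?addr_ge0 ?ler0n //.
  by apply: natr_powR34; rewrite expnM trunc_logP.
have f_neq i j : (i < j)%N -> f i <> f j.
  move=> ij; apply: interleaved_set_neq => [|y|] //.
    exact: leq_ltn_trans (uU _) (Ug i).
  by rewrite /g mulnCA -expnS leq_mul2l leq_exp2l // ij orbT.
have f_inj : injective f.
  move=> i j fij; have [/f_neq|/f_neq/nesym|//] := ltngtP i j; by rewrite fij.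
move=> good_fin; apply: infinite_nat.
have := finite_preimage (f := f) (fun i j _ _ => @f_inj i j) good_fin.
by apply: sub_finite_set => j _; exact: f_good.
Qed.
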